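(* Let $\Omega\subset\mathbb{R}^n$ be a bounded open set with diameter $d=\operatorname{diam}(\Omega)$, let $s\in(0,1)$, and let $G$ be a Young function such that $1<p^-\le \frac{t g(t)}{G(t)}\le p^+<\infty$ for all $t>0$. Then the quantities $\lambda_1=\inf\{\lambda_{1,\mu}:\mu>0\}$ and $\alpha_1=\inf\{\alpha_{1,\mu}:\mu>0\}$ are strictly positive and comparable. More precisely, there is a constant $C>0$ depending only on $n,s,p^-,p^+$ such that $$C\min\{d^{-sp^-},d^{-sp^+}\}\le\frac{p^-}{p^+}\alpha_1\le\lambda_1\le\frac{p^+}{p^-}\alpha_1.$$
   Context: A Young function is a function $G:[0,\infty)\to[0,\infty)$ of the form $G(t)=\int_0^t g(\tau)\,d\tau$, where $g:[0,\infty)\to[0,\infty)$ is right continuous and nondecreasing, $g(0)=0$, $g(t)>0$ for $t>0$, and $\lim_{t\to\infty}g(t)=\infty$. Put $D_su(x,y)=\frac{u(x)-u(y)}{|x-y|^s}$. For an open set $U\subseteq\mathbb{R}^n$, $W^{s,G}(U)$ is the set of measurable $u:\mathbb{R}^n\to\mathbb{R}$ with $\int_U G(|u|)\,dx<\infty$ and $\iint_{\mathbb{R}^n\times\mathbb{R}^n}G(|D_su|)\frac{dx\,dy}{|x-y|^n}<\infty$, and $W^{s,G}_0(\Omega)=\{u\in W^{s,G}(\mathbb{R}^n):u=0\text{ a.e. in }\mathbb{R}^n\setminus\Omega\}$. Let $$\mathcal{F}(u)=\iint_{\mathbb{R}^n\times\mathbb{R}^n}G(|D_su|)\frac{dx\,dy}{|x-y|^n},\quad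 \mathcal{G}(u)=\int_\Omega G(|u|)\,dx,\quad M_\mu=\{u\in W^{s,G}_0(\Omega):\mathcal{G}(u)=\mu\}.$$ For $\mu>0$, $\alpha_{1,\mu}=\inf_{u\in M_\mu}\mathcal{F}(u)/\mathcal{G}(u)$, $u_{1,\mu}\in M_\mu$ denotes a (non-negative) function attaining this infimum, and $\lambda_{1,\mu}$ is the associated Lagrange multiplier (eigenvalue): $$\iint_{\mathbb{R}^n\times\mathbb{R}^n}g(|D_su_{1,\mu}|)\frac{D_su_{1,\mu}}{|D_su_{1,\mu}|}D_sv\,\frac{dx\,dy}{|x-y|^n}=\lambda_{1,\mu}\int_\Omega g(|u_{1,\mu}|)\frac{u_{1,\mu}}{|u_{1,\mu}|}v\,dx\quad\text{for all }v\in W^{s,G}_0(\Omega),$$ where $g(|a|)\frac{a}{|a|}$ is understood as $0$ when $a=0$. (Such $u_{1,\mu}$ and $\lambda_{1,\mu}$ exist for every $\mu>0$.) *)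

(* Defs.v *)
From HB Require Import structures.
From mathcomp Require Import all_boot all_order all_algebra.
From mathcomp Require Import all_classical all_reals all_analysis.
Set Implicit Arguments.
Unset Strict Implicit.
Unset Printing Implicit Defensive.
Import Order.TTheory GRing.Theory Num.Theory.
Import numFieldNormedType.Exports.
Local Open Scope classical_set_scope.
Local Open Scope ring_scope.

(* R^n is 'rV[R]_n with the library's topology, the product (Borel)
   sigma-algebra and the n-dimensional Lebesgue measure built below. *)

Section measurable_rV.
Context {d} {T : measurableType d}.
Variable n : nat.

Let coors : 'I_n -> 'rV[T]_n -> T := fun i x => x ord0 i.

Let rV_set0 : g_sigma_preimage coors set0.
Proof. exact: sigma_algebra0. Qed.

Let rV_setC A : g_sigma_preimage coors A -> g_sigma_preimage coors (~` A).
Proof. exact: sigma_algebraC. Qed.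

Let rV_bigcup (F : _^nat) : (forall i, g_sigma_preimage coors (F i)) ->
  g_sigma_preimage coors (\bigcup_i (F i)).
Proof. exact: sigma_algebra_bigcup. Qed.

HB.instance Definition _ := @isMeasurable.Build (measure_tuple_display d)
  'rV[T]_n (g_sigma_preimage coors) rV_set0 rV_setC rV_bigcup.

End measurable_rV.

Lemma measurable_coord d (T : measurableType d) n (i : 'I_n) :
  measurable_fun [set: 'rV[T]_n] (fun x => x ord0 i).
Proof.
move=> _ Y mY; rewrite setTI; apply: sub_sigma_algebra => /=.
rewrite -bigcup_seq/=; exists i => /=; first by rewrite mem_index_enum.
by exists Y => //; rewrite setTI.
Qed.

Lemma measurable_fun_coordP d d' (S : measurableType d) (T : measurableType d')
    n (f : S -> 'rV[T]_n) :
  (forall i, measurable_fun [set: S] (fun x => f x ord0 i)) ->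
  measurable_fun [set: S] f.
Proof.
move=> mf _ Y mY; rewrite setTI.
suff: g_sigma_preimage (fun i (x : 'rV[T]_n) => x ord0 i) `<=`
    [set A | measurable (f @^-1` A)] by apply.
apply: smallest_sub.
  split => /=.
  - by rewrite preimage_set0.
  - by move=> A mA; rewrite setTD preimage_setC; exact: measurableC.
  - by move=> F mF; rewrite preimage_bigcup; exact: bigcup_measurable.
rewrite -bigcup_seq; apply: bigcup_sub => i _ A [B mB <-] /=.
by rewrite -[X in measurable X]setTI setTI; exact: mf.
Qed.

Section cons_rV.
Context {R : realType}.
Implicit Types n : nat.

Definition cons_rV n (p : R * 'rV[R]_n) : 'rV[R]_n.+1 :=
  \row_i (if unlift ord0 i is Some j then p.2 ord0 j else p.1).

Definition uncons_rV n (x : 'rV[R]_n.+1) : R * 'rV[R]_n :=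
  (x ord0 ord0, \row_j x ord0 (lift ord0 j)).

Lemma cons_rVK n : cancel (@cons_rV n) (@uncons_rV n).
Proof.
case=> a x; congr pair; first by rewrite mxE unlift_none.
by apply/rowP => j; rewrite !mxE liftK.
Qed.

Lemma uncons_rVK n : cancel (@uncons_rV n) (@cons_rV n).
Proof.
move=> x; apply/rowP => i; rewrite mxE.
by case: unliftP => [j ->|->] //=; rewrite mxE.
Qed.

Lemma measurable_cons_rV n :
  measurable_fun [set: measurableTypeR R * 'rV[R]_n] (@cons_rV n).
Proof.
apply: measurable_fun_coordP => i; case: (unliftP ord0 i) => [j|] ->.
- apply: (eq_measurable_fun (fun p : measurableTypeR R * 'rV[R]_n => p.2 ord0 j)).
    by move=> p _; rewrite mxE liftK.
  apply: (@measurableT_comp _ _ _ _ _ _ (fun x : 'rV[R]_n => x ord0 j)) => //.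
  exact: measurable_coord.
- apply: (eq_measurable_fun fst) => // p _.
  by rewrite mxE unlift_none.
Qed.

Lemma measurable_uncons_rV n :
  measurable_fun [set: 'rV[R]_n.+1]
    (@uncons_rV n : _ -> measurableTypeR R * 'rV[R]_n).
Proof.
apply: measurable_fun_pair; first exact: measurable_coord.
apply: measurable_fun_coordP => j.
apply: (eq_measurable_fun (fun x : 'rV[R]_n.+1 => x ord0 (lift ord0 j))).
  by move=> x _; rewrite mxE.
exact: measurable_coord.
Qed.

End cons_rV.

Section lebesgue_measure_rV.
Context {R : realType}.
Local Open Scope ereal_scope.

Section step.
Variables (n : nat) (m : {sigma_finite_measure set 'rV[R]_n -> \bar R}).

Definition cons_measure : set 'rV[R]_n.+1 -> \bar R :=
  pushforward (lebesgue_measure \x m) (@cons_rV R n).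

Let preimage_cons_measurable A :
  measurable A -> measurable (@cons_rV R n @^-1` A).
Proof.
by move=> mA; rewrite -[X in measurable X]setTI; exact: measurable_cons_rV.
Qed.

Let cons_measure0 : cons_measure set0 = 0.
Proof. by rewrite /cons_measure /pushforward preimage_set0 measure0. Qed.

Let cons_measure_ge0 A : 0 <= cons_measure A.
Proof. by rewrite /cons_measure /pushforward; exact: measure_ge0. Qed.

Let cons_measure_sigma_additive : semi_sigma_additive cons_measure.
Proof.
move=> F mF tF mUF; rewrite /cons_measure /pushforward preimage_bigcup.
apply: measure_semi_sigma_additive.
- by move=> k; exact: preimage_cons_measurable.
- apply/trivIsetP => /= i j _ _ ij; rewrite -preimage_setI.
  by move/trivIsetP : tF => /(_ _ _ _ _ ij) ->//; rewrite preimage_set0.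
- by rewrite -preimage_bigcup; exact: preimage_cons_measurable.
Qed.

HB.instance Definition _ := isMeasure.Build _ _ _ cons_measure
  cons_measure0 cons_measure_ge0 cons_measure_sigma_additive.

Let cons_measure_sigma_finite : sigma_finite setT cons_measure.
Proof.
have /sigma_finiteP[F [TF ndF mF]] := sigma_finiteT (@lebesgue_measure R).
have /sigma_finiteP[K [TK ndK mK]] := sigma_finiteT m.
exists (fun k => @uncons_rV R n @^-1` (F k `*` K k)).
  apply/esym; rewrite -subTset => x _.
  have [i _ Fi] : (\bigcup_i F i) (uncons_rV x).1 by rewrite -TF.
  have [j _ Kj] : (\bigcup_j K j) (uncons_rV x).2 by rewrite -TK.
  exists (maxn i j) => //; split.
    by move: Fi; exact/subsetPset/ndF/leq_maxl.
  by move: Kj; exact/subsetPset/ndK/leq_maxr.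
move=> k; have [mFk Fkoo] := mF k; have [mKk Kkoo] := mK k; split.
  rewrite -[X in measurable X]setTI; apply: measurable_uncons_rV => //.
  exact: measurableX.
rewrite /cons_measure /pushforward -comp_preimage.
rewrite (_ : _ \o _ = id) ?preimage_id.
  by rewrite product_measure1E// lte_mul_pinfty// ge0_fin_numE.
by apply/funext => p /=; rewrite cons_rVK.
Qed.

HB.instance Definition _ :=
  Measure_isSigmaFinite.Build _ _ _ cons_measure cons_measure_sigma_finite.

End step.

Fixpoint lebesgue_rV n : {sigma_finite_measure set 'rV[R]_n -> \bar R} :=
  if n is n'.+1 then cons_measure (lebesgue_rV n') else dirac (0%R : 'rV[R]_0).

End lebesgue_measure_rV.
Arguments lebesgue_rV {R} n.

Section euclidean.
Context {R : realType} {n : nat}.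
Implicit Types (x y : 'rV[R]_n) (A : set 'rV[R]_n).

(* The library's norm on 'rV[R]_n is the sup norm. *)
Definition eucl_norm x : R := Num.sqrt (\sum_(i < n) x ord0 i ^+ 2).

(* A real supremum: meaningful for A bounded and nonempty. *)
Definition diam A : R := sup [set eucl_norm (x - y) | x in A & y in A].

End euclidean.

Section young.
Context {R : realType}.

(* Only the values of G and g on [0, +oo[ matter. *)
Record young_function (G g : R -> R) : Prop := YoungFunction {
  young_ge0 : forall t, 0 <= t -> 0 <= g t;
  young_rcont : forall t, 0 <= t -> g x @[x --> t^'+] --> g t;
  young_nondecr : forall t1 t2, 0 <= t1 -> t1 <= t2 -> g t1 <= g t2;
  young0 : g 0 = 0;
  young_gt0 : forall t, 0 < t -> 0 < g t;
  young_cvgy : g x @[x --> +oo] --> +oo;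
  youngE : forall t, 0 <= t -> G t = \int[lebesgue_measure]_(x in `[0, t]) g x
}.

End young.

Section fractional_orlicz_sobolev.
Context {R : realType} {n : nat}.
Local Notation E := 'rV[R]_n.
Variables (s : R) (G g : R -> R).
Implicit Types (u v : E -> R) (U Omega : set E).

(* On the (null) diagonal x = y this is 0, since _ / 0 = 0. *)
Definition hquot u (x y : E) : R := (u x - u y) / (eucl_norm (x - y) `^ s).

Definition energy u : \bar R :=
  (\int[lebesgue_rV n \x lebesgue_rV n]_z
    (G `|hquot u z.1 z.2| / eucl_norm (z.1 - z.2) ^+ n)%:E)%E.

Definition modular Omega u : \bar R :=
  (\int[lebesgue_rV n]_(x in Omega) (G `|u x|)%:E)%E.

Definition orlicz_sobolev U u : Prop :=
  [/\ measurable_fun setT u, (modular U u < +oo)%E & (energy u < +oo)%E].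

Definition orlicz_sobolev0 Omega u : Prop :=
  orlicz_sobolev setT u /\
  {ae lebesgue_rV n, forall x, ~ Omega x -> u x = 0}.

Definition modular_sphere Omega (mu : R) : set (E -> R) :=
  [set u | orlicz_sobolev0 Omega u /\ modular Omega u = mu%:E].

Definition alpha1_at Omega (mu : R) : \bar R :=
  ereal_inf [set (energy u / modular Omega u)%E | u in modular_sphere Omega mu].

Definition alpha1 Omega : \bar R :=
  ereal_inf [set alpha1_at Omega mu | mu in [set mu : R | 0 < mu]].

(* a |-> g(|a|) a/|a|, equal to 0 at a = 0 since _ / 0 = 0. *)
Definition odd_ext (a : R) : R := g `|a| * (a / `|a|).

Definition weak_eigenpair Omega u (lambda : R) : Prop :=
  forall v, orlicz_sobolev0 Omega v ->
    (\int[lebesgue_rV n \x lebesgue_rV n]_z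
       (odd_ext (hquot u z.1 z.2) * hquot v z.1 z.2
          / eucl_norm (z.1 - z.2) ^+ n)%:E
     = lambda%:E * \int[lebesgue_rV n]_(x in Omega) (odd_ext (u x) * v x)%:E)%E.

(* u is an admissible choice of u_{1,mu}, and lambda that of lambda_{1,mu}. *)
Definition first_eigenpair Omega (mu : R) u (lambda : R) : Prop :=
  [/\ modular_sphere Omega mu u,
      {ae lebesgue_rV n, forall x, 0 <= u x},
      (energy u / modular Omega u)%E = alpha1_at Omega mu
    & weak_eigenpair Omega u lambda].

End fractional_orlicz_sobolev.

(* The infimum over mu > 0 of a chosen family mu |-> lambda_{1,mu}. *)
Definition lambda1 {R : realType} (lambda : R -> R) : \bar R :=
  ereal_inf [set (lambda mu)%:E | mu in [set mu : R | 0 < mu]].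

(* Main.v *)
Require Import Defs.
From mathcomp Require Import all_boot all_order all_algebra.
From mathcomp Require Import all_classical all_reals all_analysis.
From mathcomp Require Import measurable_realfun ring lra.
Import Order.TTheory GRing.Theory Num.Theory.
Import numFieldNormedType.Exports.
Local Open Scope classical_set_scope.
Local Open Scope ring_scope.

(* The heart is a Poincare inequality for functions vanishing outside Omega.
   For x in Omega, the cube of side d whose i-th coordinates range over
   ]x_i + d, x_i + 2 d] misses Omega, so u = 0 almost everywhere there, while
   |x - y| <= 2 n d for y in that cube; integrating over it bounds the inner
   integral of the energy below by a multiple of G(|u(x)| / (2 n d)^s), which
   the growth of G compares with min(d^(-s p^-), d^(-s p^+)) G(|u(x)|).
   The bounds on lambda_(1,mu) come from testing the weak equation with u
   itself and p^- G(t) <= t g(t) <= p^+ G(t). *)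

(** * Lebesgue measure on R^n *)

Section rV_measure.
Context {R : realType}.
Implicit Types n : nat.

Lemma measurable_box n (A : 'I_n -> set R) :
  (forall i, measurable (A i)) ->
  measurable [set y : 'rV[R]_n | forall i, A i (y ord0 i)].
Proof.
move=> mA.
have -> : [set y : 'rV[R]_n | forall i, A i (y ord0 i)] =
    \bigcap_(i in [set: 'I_n]) ((fun y : 'rV[R]_n => y ord0 i) @^-1` A i).
  by apply/seteqP; split => y /= h i; [move=> _; exact: h|exact: h].
apply: fin_bigcap_measurable => // i _.
by rewrite -[X in measurable X]setTI; exact: measurable_coord.
Qed.

(* Rational balls of radius 1/(k+1) form a countable basis. *)
Lemma open_rV_measurable n (U : set 'rV[R]_n) : open U -> measurable U.
Proof.
move=> oU.
pose q (p : 'rV[rat]_n * nat) : 'rV[R]_n := map_mx ratr p.1.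
pose r (p : 'rV[rat]_n * nat) : R := p.2.+1%:R^-1.
have -> : U = \bigcup_(p in [set: 'rV[rat]_n * nat])
    (if pselect (ball (q p) (r p) `<=` U) then ball (q p) (r p) else set0).
  apply/seteqP; split => [x Ux|x [p _]]; last by case: pselect => // h; exact: h.
  have /nbhs_ballP[e /= e0 xeU] : nbhs x U by exact: open_nbhs_nbhs.
  (* This makes [d] at most e/2, so a ball of radius [d] containing x lies inside the ball of radius
     e about x. *)
  pose k := Num.truncn (2 / e); pose d : R := k.+1%:R^-1.
  have d0 : 0 < d by rewrite invr_gt0.
  have de : d + d <= e.
    have : 2 / e < k.+1%:R by rewrite truncnS_gt.
    rewrite ltr_pdivrMr// => /ltW h.
    by rewrite -mulr2n -[d *+ 2]mulr_natl ler_pdivrMr// mulrC.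
  have /choice[f fP] : forall i : 'I_n, exists a : rat, ball (x ord0 i) d (ratr a).
    move=> i; have /rat_in_itvoo[a] : x ord0 i - d < x ord0 i + d by lra.
    rewrite in_itv/= => ha; exists a; rewrite /ball/= ltr_norml; lra.
  pose p := (\row_i f i : 'rV[rat]_n, k).
  have qx : ball (q p) (r p) x.
    apply: ball_sym; split => // i j; rewrite !mxE [i]ord1; exact: fP.
  exists p => //; case: pselect => // -[].
  move=> y qy; apply: xeU; apply: (le_ball de).
  exact: ball_triangle (ball_sym qx) qy.
apply: countable_bigcupT_measurable => [|p]; first exact: countableP; case: pselect => //= _.
(* Balls of the sup norm are boxes. *)
have -> : ball (q p) (r p) =
    [set y : 'rV[R]_n | forall i, ball (q p ord0 i) (r p) (y ord0 i)].
  apply/seteqP; split => y /=; first by move=> [_ h] i; exact: h.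
  by move=> h; split => [|i j]; [rewrite invr_gt0|rewrite [i]ord1; exact: h].
apply: (@measurable_box n (fun i => ball (q p ord0 i) (r p))) => i.
exact: measurable_ball.
Qed.

(** Induction on the dimension: [cons_rV] pulls a box back to its first side times the box of the
    other sides. In dimension 0 the Dirac mass gives 1, the empty product. *)
Lemma lebesgue_rV_box n (A : 'I_n -> set R) :
  (forall i, measurable (A i)) ->
  lebesgue_rV n [set y : 'rV[R]_n | forall i, A i (y ord0 i)] =
  (\prod_(i < n) lebesgue_measure (A i))%E.
Proof.
elim: n A => [|n IH] A mA.
  rewrite big_ord0 /= diracE mem_set// => -[].
  by [].
rewrite big_ord_recl /= /cons_measure /pushforward.
have -> : @cons_rV R n @^-1` [set y | forall i, A i (y ord0 i)] =
    A ord0 `*` [set y : 'rV[R]_n | forall i, A (lift ord0 i) (y ord0 i)].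
  apply/seteqP; split => -[a y] /=.
    move=> h; split => [|i].
      by have := h ord0; rewrite mxE unlift_none.
    by have := h (lift ord0 i); rewrite mxE liftK.
  move=> [ha h] i; rewrite mxE; case: unliftP => [j ->|->] //=.
rewrite product_measure1E// ?(IH (fun i => A (lift ord0 i)))//.
  exact: mA.
by apply: (@measurable_box n (fun i => A (lift ord0 i))) => i; exact: mA.
Qed.

End rV_measure.

(** * Growth of Young functions *)

(** Monotonicity is known only on the half-line; precomposing with [Num.max 0] extends it to all of
    R without changing the values at |x|. *)
Lemma measurable_nondecreasing_normr (R : realType) (f : R -> R) :
  (forall a b, 0 <= a -> a <= b -> f a <= f b) ->
  measurable_fun setT (fun x : R => f `|x|).
Proof.
move=> f_nd.
have h : measurable_fun setT (fun x : R => f (Num.max 0 x)).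
  apply: nondecreasing_measurable => // x y xy.
  apply: f_nd; first by rewrite le_max lexx.
  by rewrite ge_max !le_max lexx/= xy orbT.
apply: (eq_measurable_fun ((fun x : R => f (Num.max 0 x)) \o (fun x : R => `|x|))).
  by move=> x _ /=; rewrite max_r.
exact: measurableT_comp.
Qed.

Section young_growth.
Context {R : realType}.
Variables G g : R -> R.
Hypothesis hG : young_function G g.

Lemma young_density_measurable : measurable_fun setT (fun x : R => g `|x|).
Proof. apply: measurable_nondecreasing_normr => x y x0 xy; exact: (young_nondecr hG). Qed.

Lemma young_density_integrable (t : R) :
  lebesgue_measure.-integrable `[0, t] (EFin \o g).
Proof.
apply: measurable_bounded_integrable => //.
- by rewrite /= lebesgue_measure_itv/=; case: ifPn => // _; rewrite -EFinB ltry.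
- apply: (eq_measurable_fun (fun x : R => g `|x|)).
    by move=> x; rewrite inE/= in_itv/= => /andP[x0 _]; rewrite ger0_norm.
  exact: measurable_funS young_density_measurable.
- exists (g t); split; first exact: num_real.
  move=> M /ltW gM x /=; rewrite in_itv/= => /andP[x0 xt].
  by apply: le_trans gM; rewrite ger0_norm ?(young_ge0 hG)// (young_nondecr hG).
Qed.

(** The increment of G is the integral of g over ]a, b], where g lies between g(a) and g(b). *)
Lemma young_increment (a b : R) : 0 <= a -> a <= b ->
  (b - a) * g a <= G b - G a <= (b - a) * g b.
Proof.
move=> a0 ab; have b0 := le_trans a0 ab.
rewrite (youngE hG a0) (youngE hG b0) Rintegral_itvB; last first.
- by rewrite bnd_simp.
- by rewrite bnd_simp.
- exact: young_density_integrable.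
have mab : lebesgue_measure `]a, b] = (b - a)%:E :> \bar R.
  by rewrite lebesgue_measure_itv/= lte_fin; case: ltgtP ab => // ->; rewrite subrr.
have ig : lebesgue_measure.-integrable `]a, b] (EFin \o g).
  apply: integrableS (young_density_integrable b) => //.
  by move=> x /=; rewrite !in_itv/= => /andP[ax ->]; rewrite (le_trans a0 (ltW ax)).
have ic c : lebesgue_measure.-integrable `]a, b] (EFin \o cst c : R -> \bar R).
  apply: measurable_bounded_integrable => //; first by rewrite /= mab ltry.
  exists `|c|; split; first exact: num_real.
  by move=> M /ltW cM x _.
have cE c : (b - a) * c = \int[lebesgue_measure]_(x in `]a, b]) (cst c) x.
  by rewrite Rintegral_cst//= mab mulrC.
rewrite !cE; apply/andP; split; apply: le_Rintegral => //= x;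
  rewrite in_itv/= => /andP[ax xb]; apply: (young_nondecr hG) => //.
  exact: ltW.
exact: le_trans a0 (ltW ax).
Qed.

Lemma young_fun_nondecr (a b : R) : 0 <= a -> a <= b -> G a <= G b.
Proof.
move=> a0 ab; have /andP[+ _] := young_increment _ _ a0 ab.
rewrite -[G a <= _]subr_ge0; apply: le_trans; apply: mulr_ge0.
  by rewrite subr_ge0.
exact: (young_ge0 hG).
Qed.

Lemma young_fun0 : G 0 = 0.
Proof. by rewrite (youngE hG)// set_itv1 Rintegral_set1. Qed.

Lemma young_fun_ge0 (t : R) : 0 <= t -> 0 <= G t.
Proof. by move=> t0; rewrite -young_fun0; exact: young_fun_nondecr. Qed.

(** G(t) - G(t/2) is at least (t/2) g(t/2) > 0. *)
Lemma young_fun_gt0 (t : R) : 0 < t -> 0 < G t.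
Proof.
move=> t0; have t20 : 0 < t / 2 by rewrite divr_gt0.
have t2t : t / 2 <= t by lra.
have /andP[+ _] := young_increment _ _ (ltW t20) t2t.
have := young_fun_ge0 _ (ltW t20).
suff : 0 < (t - t / 2) * g (t / 2) by lra.
by rewrite mulr_gt0 ?(young_gt0 hG)//; lra.
Qed.

Lemma young_fun_measurable : measurable_fun setT (fun x : R => G `|x|).
Proof. apply: measurable_nondecreasing_normr => x y x0 xy; exact: young_fun_nondecr. Qed.

Variables pm pp : R.
Hypothesis hpm : 0 < pm.
Hypothesis hp : forall t, 0 < t -> pm <= t * g t / G t /\ t * g t / G t <= pp.

(** The growth hypothesis with its denominator cleared, which makes it hold at t = 0 too. *)
Lemma young_index (t : R) : 0 <= t -> pm * G t <= t * g t <= pp * G t.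
Proof.
rewrite le_eqVlt => /predU1P[<-|t0].
  by rewrite young_fun0 !mulr0 mul0r lexx.
have G0 := young_fun_gt0 _ t0.
have [h1 h2] := hp _ t0.
by apply/andP; split; [rewrite -ler_pdivlMr|rewrite -ler_pdivrMr].
Qed.

(** The exponent in the lower bound for G(rt): p^- for r >= 1 and p^+ for r < 1. The argument is r -
    1 or ln r, whose sign decides. *)
Let exponent (x : R) := if 0 <= x then pm else pp.

(** First-order form of the scaling bound: the increment of G between t and rt is compared with (r -
    1) t g(t), then t g(t) with p^- G(t) or p^+ G(t) according to the sign of r - 1. *)
Lemma young_fun_step (r t : R) : 0 < r -> 0 < t ->
  (1 + exponent (r - 1) * (r - 1)) * G t <= G (r * t).
Proof.
move=> r0 t0; have rt0 : 0 < r * t by rewrite mulr_gt0.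
have /andP[h1 h2] := young_index _ (ltW t0).
rewrite /exponent; case: ifPn => [r1|].
  have trt : t <= r * t by nra.
  have /andP[h _] := young_increment _ _ (ltW t0) trt.
  have k : (r - 1) * (pm * G t) <= (r - 1) * (t * g t) by rewrite ler_wpM2l.
  nra.
rewrite -ltNge => r1.
have rtt : r * t <= t by nra.
have /andP[_ h] := young_increment _ _ (ltW rt0) rtt.
have r1' : 0 <= 1 - r by lra.
have k : (1 - r) * (t * g t) <= (1 - r) * (pp * G t) by rewrite ler_wpM2l.
nra.
Qed.

(** After taking reciprocals, exp(z) >= 1 + z at z = 2y^2 - y suffices, because (1 + y)(1 - y +
    2y^2) = 1 + y^2 (1 + 2y) >= 1 for y >= -1/2. *)
Lemma expR_ge_step (y : R) : - 2^-1 <= y -> expR (y - 2 * y ^+ 2) <= 1 + y.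
Proof.
move=> y1.
have y0 : 0 < 1 + y by lra.
rewrite -[1 + y]invrK -ler_pV2 ?inE ?unitfE ?invr_gt0 ?expR_gt0 ?invr_neq0 ?gt_eqF ?expR_gt0//.
rewrite invrK -expRN; apply: le_trans (expR_ge1Dx _).
rewrite -[(1 + y)^-1]mul1r ler_pdivrMr//; nra.
Qed.

(** The lower half of the limit (1 + z/N)^N -> exp(z): the N-th power of [expR_ge_step] at z/N loses
    only 2z^2/N in the exponent. *)
Lemma expR_le_powX (z e : R) : 0 < e ->
  exists N : nat, [/\ (0 < N)%N, 0 <= 1 + z / N%:R &
    expR (z - e) <= (1 + z / N%:R) ^+ N].
Proof.
(* For N > M, the first term ensures z/N >= -1/2 and the second ensures 2z^2/N <= e. *)
move=> e0; pose M := 2 * `|z| + 2 * z ^+ 2 / e.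
have M1 : 0 <= 2 * z ^+ 2 / e by rewrite divr_ge0 ?(ltW e0)// mulr_ge0 ?sqr_ge0.
have := truncnS_gt M; set N := (Num.truncn M).+1 => MN.
have N0 : 0 < N%:R :> R by [].
have zN : - 2^-1 <= z / N%:R.
  rewrite ler_pdivlMr// mulNr lerNl; have := ler_norm (- z); rewrite normrN.
  have : 2 * `|z| < N%:R by apply: le_lt_trans MN; rewrite /M lerDl.
  lra.
have zN1 : 0 <= 1 + z / N%:R by lra.
exists N; split => //.
apply: (@le_trans _ _ (expR (z / N%:R - 2 * (z / N%:R) ^+ 2) ^+ N)); last first.
  by rewrite lerXn2r ?nnegrE ?expR_ge0 ?expR_ge_step.
rewrite -expRM_natl ler_expR mulrBr.
have -> : N%:R * (z / N%:R) = z by field; rewrite gt_eqF.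
have -> : N%:R * (2 * (z / N%:R) ^+ 2) = 2 * z ^+ 2 / N%:R by field; rewrite gt_eqF.
rewrite lerD2l lerN2 ler_pdivrMr// -ler_pdivrMl// mulrC.
by apply: ltW; apply: le_lt_trans MN; rewrite /M lerDr mulr_ge0.
Qed.

(* Iterating the step G(e^(x/N) t) >= (1 + p x/N) G(t), and letting N grow. *)
Lemma young_fun_expR (x t : R) : 0 < t ->
  expR (exponent x * x) * G t <= G (expR x * t).
Proof.
move=> t0; set p := exponent x.
have Gt0 := young_fun_gt0 _ t0.
have p0 : 0 <= p.
  rewrite /p /exponent; case: ifP => _; first exact: ltW.
  by have [h1 h2] := hp 1 ltr01; apply: le_trans (le_trans h1 h2); exact: ltW.
have iter N (y : R) (ey : exponent y = p) : 0 <= 1 + p * y ->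
    (1 + p * y) ^+ N * G t <= G (expR (N%:R * y) * t).
  move=> y1; elim: N => [|N IH]; first by rewrite mul0r expR0 expr0 !mul1r.
  rewrite -natr1 mulrDl mul1r [N%:R * y + y]addrC expRD exprS -!mulrA.
  have et0 : 0 < expR (N%:R * y) * t by rewrite mulr_gt0 ?expR_gt0.
  apply: le_trans (young_fun_step _ _ (expR_gt0 y) et0).
  (* [expR y - 1] has the sign of [y], so every step uses the same exponent. *)
  have -> : exponent (expR y - 1) = p by rewrite -ey /exponent subr_ge0 -[X in X <= _]expR0 ler_expR.
  apply: ler_pM => //; first by rewrite mulr_ge0 ?exprn_ge0 ?(ltW Gt0).
  by rewrite lerD2l ler_wpM2l//; have := expR_ge1Dx y; lra.
have Gxt0 : 0 < G (expR x * t) by rewrite young_fun_gt0// mulr_gt0 ?expR_gt0.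
(* In logarithms, the loss due to a finite N becomes an additive error [e], which is arbitrary. *)
rewrite -ler_pdivlMr// -[leRHS]lnK ?posrE ?divr_gt0// ler_expR.
apply/ler_addgt0Pr => e e0; rewrite -lerBlDr -ler_expR lnK ?posrE ?divr_gt0//.
rewrite ler_pdivlMr//.
have [N [N0 zN zeN]] := expR_le_powX (p * x) e e0.
have N0' : 0 < N%:R :> R by rewrite ltr0n.
have ey : exponent (x / N%:R) = p.
  by rewrite /p /exponent pmulr_lge0 ?invr_gt0.
rewrite -mulrA in zN zeN.
have := iter N _ ey zN.
have -> : N%:R * (x / N%:R) = x by field; rewrite gt_eqF.
by apply: le_trans; rewrite ler_wpM2r// ltW.
Qed.

(** This is [young_fun_expR] at x = ln a; the minimum removes the case distinction on a >= 1. *)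
Lemma young_fun_scale (a t : R) : 0 < a -> 0 <= t ->
  Num.min (a `^ pm) (a `^ pp) * G t <= G (a * t).
Proof.
move=> a0; rewrite le_eqVlt => /predU1P[<-|t0].
  by rewrite mulr0 young_fun0 mulr0.
have := young_fun_expR (ln a) _ t0; rewrite lnK ?posrE//; apply: le_trans.
rewrite ler_wpM2r ?young_fun_ge0 ?(ltW t0)// /powR gt_eqF//.
by rewrite ge_min /exponent; case: ifP => _; rewrite lexx ?orbT.
Qed.

End young_growth.

(** * The Euclidean norm *)

Section euclidean.
Context {R : realType} {n : nat}.
Implicit Types (x y : 'rV[R]_n) (A : set 'rV[R]_n).

Lemma eucl_norm_ge0 x : 0 <= eucl_norm x.
Proof. exact: sqrtr_ge0. Qed.

Lemma eucl_norm_coord x (i : 'I_n) : `|x ord0 i| <= eucl_norm x.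
Proof.
rewrite -sqrtr_sqr ler_sqrt ?sumr_ge0// => [|j _]; last exact: sqr_ge0.
by rewrite (bigD1 i)//= lerDl sumr_ge0// => j _; exact: sqr_ge0.
Qed.

(** The factor n, cruder than its square root, comes from n <= n^2. *)
Lemma eucl_norm_le x (c : R) : 0 <= c -> (forall i, `|x ord0 i| <= c) ->
  eucl_norm x <= n%:R * c.
Proof.
move=> c0 xc; rewrite -[leRHS]ger0_norm ?mulr_ge0// -sqrtr_sqr ler_sqrt ?sqr_ge0//.
apply: (@le_trans _ _ (\sum_(i < n) c ^+ 2)).
  by apply: ler_sum => i _; rewrite -real_normK ?num_real// lerXn2r ?nnegrE.
rewrite sumr_const card_ord -[_ *+ n]mulr_natl exprMn ler_wpM2r ?sqr_ge0//.
by rewrite -natrX ler_nat; case: (n) => // k; rewrite expnS leq_pmulr.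
Qed.

Lemma measurable_eucl_normB :
  measurable_fun setT (fun z : 'rV[R]_n * 'rV[R]_n => eucl_norm (z.1 - z.2)).
Proof.
apply: (eq_measurable_fun (fun z : 'rV[R]_n * 'rV[R]_n =>
    (\sum_(i < n) (z.1 ord0 i - z.2 ord0 i) ^+ 2) `^ 2^-1)).
  move=> z _; rewrite powR12_sqrt ?sumr_ge0// => [|i _]; last exact: sqr_ge0.
  by congr Num.sqrt; apply: eq_bigr => i _; rewrite !mxE.
apply: (@measurableT_comp _ _ _ _ _ _ (@powR R ^~ 2^-1)) => //.
apply: measurable_sum => i; apply: measurable_funX; apply: measurable_funB.
  apply: (@measurableT_comp _ _ _ _ _ _ (fun x : 'rV[R]_n => x ord0 i)) => //.
  exact: measurable_coord.
apply: (@measurableT_comp _ _ _ _ _ _ (fun x : 'rV[R]_n => x ord0 i)) => //.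
exact: measurable_coord.
Qed.

(** As [diam] is a real supremum, the distances must first be bounded; a sup norm bound on A does
    this through [eucl_norm_le]. *)
Lemma eucl_norm_le_diam A x y : bounded_set A -> A x -> A y ->
  eucl_norm (x - y) <= diam A.
Proof.
move=> bA Ax Ay; apply: ub_le_sup; last by exists x => //; exists y.
have [M [Mr MA]] := bA.
have {}MA z : A z -> forall i, `|z ord0 i| <= `|M| + 1.
  move=> Az i; apply: le_trans (MA _ _ _ Az).
    rewrite /Num.Def.normr /= mx_normrE.
    exact: (le_bigmax _ (fun ij : 'I_1 * 'I_n => `|z ij.1 ij.2|) (ord0, i)).
  by rewrite (le_lt_trans (ler_norm M))// ltrDl.
exists (n%:R * ((`|M| + 1) + (`|M| + 1))) => _ [a Aa [b Ab <-]].
apply: eucl_norm_le => [|i]; first by rewrite !addr_ge0.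
by rewrite !mxE (le_trans (ler_normB _ _))// lerD ?MA.
Qed.

Lemma diam_gt0 A : (0 < n)%N -> open A -> bounded_set A -> A !=set0 -> 0 < diam A.
Proof.
move=> n0 oA bA [x Ax].
have /nbhs_ballP[e /= e0 xeA] : nbhs x A by exact: open_nbhs_nbhs.
(* Still within sup distance e of x, yet at Euclidean distance at least e/2. *)
pose y : 'rV[R]_n := x + const_mx (e / 2).
have Ay : A y.
  apply: xeA; split => // i j; rewrite /ball/= !mxE [i]ord1 opprD addNKr normrN.
  by rewrite gtr0_norm ?divr_gt0//; lra.
apply: lt_le_trans (eucl_norm_le_diam _ _ _ bA Ay Ax).
apply: lt_le_trans (eucl_norm_coord _ (Ordinal n0)).
by rewrite !mxE addrAC subrr add0r gtr0_norm ?divr_gt0.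
Qed.

End euclidean.

(** * Poincare inequality *)

Section poincare.
Context {R : realType} {n : nat}.
Local Notation E := 'rV[R]_n.
Variables (s : R) (G g : R -> R).
Hypothesis hG : young_function G g.
Implicit Types (u : E -> R) (Omega : set E).

Lemma measurable_hquot u : measurable_fun setT u ->
  measurable_fun setT (fun z : E * E => hquot s u z.1 z.2).
Proof.
move=> mu.
apply: (eq_measurable_fun (fun z : E * E =>
    (u z.1 - u z.2) * eucl_norm (z.1 - z.2) `^ (- s))).
  by move=> z _; rewrite powRN.
apply: measurable_funM.
  by apply: measurable_funB; exact: measurableT_comp.
apply: (@measurableT_comp _ _ _ _ _ _ (@powR R ^~ (- s))) => //.
exact: measurable_eucl_normB.
Qed.

(** A general f covers both G(|a|), for the energy, and |a| g(|a|), for the weak equation tested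
    with u. *)
Lemma measurable_hquot_div (f : R -> R) u :
  measurable_fun setT f -> measurable_fun setT u ->
  measurable_fun setT (fun z : E * E =>
    (f (hquot s u z.1 z.2) / eucl_norm (z.1 - z.2) ^+ n)%:E).
Proof.
move=> mf mu; apply/measurable_EFinP.
apply: (eq_measurable_fun (fun z : E * E =>
    f (hquot s u z.1 z.2) * eucl_norm (z.1 - z.2) `^ (- n%:R))).
  by move=> z _; rewrite powRN powR_mulrn// eucl_norm_ge0.
apply: measurable_funM.
  by apply: (measurableT_comp mf); exact: measurable_hquot.
apply: (@measurableT_comp _ _ _ _ _ _ (@powR R ^~ (- n%:R))) => //.
exact: measurable_eucl_normB.
Qed.

Variables pm pp : R.
Hypothesis hs : 0 < s.
Hypothesis hpm : 0 < pm.
Hypothesis hp : forall t, 0 < t -> pm <= t * g t / G t /\ t * g t / G t <= pp.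

(* Disjoint from every set of diameter at most d that contains x. *)
Let cube (x : E) (d : R) : set E :=
  [set y | forall i, y ord0 i \in `]x ord0 i + d, x ord0 i + (d + d)] ].

Let measurable_cube x d : measurable (cube x d).
Proof.
exact: (@measurable_box _ n
  (fun i => `]x ord0 i + d, x ord0 i + (d + d)]%classic)).
Qed.

Let cube_measure x d : 0 < d -> lebesgue_rV n (cube x d) = (d ^+ n)%:E.
Proof.
move=> d0.
rewrite (@lebesgue_rV_box _ n
  (fun i => `]x ord0 i + d, x ord0 i + (d + d)]%classic))//.
rewrite (eq_bigr (fun=> d%:E)) => [|i _].
  by rewrite prodEFin prodr_const card_ord.
rewrite lebesgue_measure_itv/= lte_fin ltrD2l ltrDl d0 -EFinB; congr EFin; lra.
Qed.

(** The sides are open on the left, so the lower bound is strict and excludes y from Omega when d is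
    its diameter. The upper bound holds since no coordinate differs by more than 2d. *)
Let cube_norm x y d : (0 < n)%N -> 0 < d -> cube x d y ->
  d < eucl_norm (x - y) <= 2 * n%:R * d.
Proof.
move=> n0 d0 xdy; apply/andP; split.
  apply: lt_le_trans (eucl_norm_coord _ (Ordinal n0)); rewrite !mxE.
  by have := xdy (Ordinal n0); rewrite in_itv/= ltr_normr => /andP[h _]; lra.
rewrite mulrAC mulrC; apply: eucl_norm_le => [|i]; first by rewrite mulr_ge0 ?ltW.
by have := xdy i; rewrite in_itv/= !mxE ler_norml => /andP[h1 h2]; lra.
Qed.

(** Replacing N by D decreases both the argument of G and the weight; then [young_fun_scale] applies
    with factor D^(-s). *)
Lemma kernel_lower_bound (a N D : R) : 0 < N -> N <= D ->
  Num.min (D `^ (- (s * pm))) (D `^ (- (s * pp))) * (D ^+ n)^-1 * G `|a| <=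
  G `|a / N `^ s| / N ^+ n.
Proof.
move=> N0 ND; have D0 := lt_le_trans N0 ND.
rewrite mulrAC; apply: ler_pM.
- by rewrite mulr_ge0 ?le_min ?powR_ge0 ?(young_fun_ge0 _ _ hG).
- by rewrite invr_ge0 exprn_ge0 ?ltW.
- have -> : D `^ (- (s * pm)) = (D `^ (- s)) `^ pm by rewrite -powRrM mulNr.
  have -> : D `^ (- (s * pp)) = (D `^ (- s)) `^ pp by rewrite -powRrM mulNr.
  apply: le_trans (young_fun_scale _ _ hG _ _ hpm hp _ _ (powR_gt0 _ D0) (normr_ge0 a)) _.
  apply: (young_fun_nondecr _ _ hG); first by rewrite mulr_ge0 ?powR_ge0.
  rewrite normrM normfV (ger0_norm (powR_ge0 _ _)) mulrC ler_wpM2l// powRN.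
  by rewrite lef_pV2 ?posrE ?powR_gt0// ge0_ler_powR ?nnegrE ?(ltW N0) ?(ltW D0) ?(ltW hs).
- by rewrite lef_pV2 ?posrE ?exprn_gt0// lerXn2r ?nnegrE ?(ltW N0) ?(ltW D0).
Qed.

Lemma orlicz_poincare Omega u :
  (0 < n)%N -> open Omega -> bounded_set Omega -> Omega !=set0 ->
  orlicz_sobolev0 s G Omega u ->
  ((Num.min ((2 * n%:R * diam Omega) `^ (- (s * pm)))
            ((2 * n%:R * diam Omega) `^ (- (s * pp))) * (2 * n%:R) ^- n)%:E
     * modular G Omega u <= energy s G u)%E.
Proof.
move=> n0 oO bO O0 [[mu _ _] u0].
have d0 : 0 < diam Omega by exact: diam_gt0.
set d : R := diam Omega in d0 *; set D : R := 2 * n%:R * d.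
set m : R := Num.min _ _.
have nR0 : 0 < n%:R :> R by rewrite ltr0n.
have D0 : 0 < D by rewrite !mulr_gt0.
have m0 : 0 <= m by rewrite le_min !powR_ge0.
have mO : measurable Omega by exact: open_rV_measurable.
have mG := young_fun_measurable _ _ hG.
have mGu : measurable_fun setT (fun x => (G `|u x|)%:E).
  by apply/measurable_EFinP; exact: (measurableT_comp mG mu).
have Gge0 (a : R) : 0 <= G `|a| by rewrite (young_fun_ge0 _ _ hG).
pose f (z : E * E) : \bar R := (G `|hquot s u z.1 z.2| / eucl_norm (z.1 - z.2) ^+ n)%:E.
have f0 z : (0 <= f z)%E.
  by rewrite lee_fin divr_ge0 ?Gge0// exprn_ge0// eucl_norm_ge0.
have mf : measurable_fun setT f := measurable_hquot_div _ _ mG mu.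
(* After Tonelli, non-negativity allows restricting x to Omega and, below, y to the cube. *)
rewrite /energy /modular -/f fubini_tonelli1//.
have mF : measurable_fun setT (fubini_F (lebesgue_rV n) f).
  exact: measurable_fun_fubini_tonelli_F.
have F0 x : (0 <= fubini_F (lebesgue_rV n) f x)%E by exact: integral_ge0.
apply: (@le_trans _ _ (\int[lebesgue_rV n]_(x in Omega) fubini_F (lebesgue_rV n) f x)%E);
  last by apply: ge0_subset_integral.
rewrite -ge0_integralZl//; last 3 first.
- exact: measurable_funS mGu.
- by move=> x _; rewrite lee_fin.
- by rewrite lee_fin mulr_ge0// invr_ge0 exprn_ge0// mulr_ge0// ltW.
apply: ge0_le_integral => //.
- by move=> x _; rewrite -EFinM lee_fin !mulr_ge0// invr_ge0 exprn_ge0// mulr_ge0// ltW.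
- by apply: measurable_funeM; exact: measurable_funS mGu.
- exact: measurable_funS mF.
move=> x Ox; rewrite /fubini_F.
have mfx : measurable_fun setT (fun y => f (x, y)) by exact: measurableT_comp.
apply: (@le_trans _ _ (\int[lebesgue_rV n]_(y in cube x d) f (x, y))%E);
  last by apply: ge0_subset_integral.
(* The bound of [kernel_lower_bound] on the cube; times the volume d^n, its factor D^(-n) becomes
   (2n)^(-n). *)
pose c := m * (D ^+ n)^-1 * G `|u x|.
apply: (@le_trans _ _ (\int[lebesgue_rV n]_(y in cube x d) cst c%:E y)%E).
  rewrite integral_cst// [X in (_ <= _ * X)%E](cube_measure x d d0).
  rewrite -!EFinM lee_fin /c.
  rewrite le_eqVlt; apply/orP; left; apply/eqP; rewrite /D [(_ * d) ^+ n]exprMn; field.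
  by rewrite !expf_neq0 ?gt_eqF // mulr_gt0.
(* The comparison holds only almost everywhere, since u vanishes outside Omega only up to a null
   set. *)
apply: ae_ge0_le_integral => //.
- by move=> y _; rewrite lee_fin /c !mulr_ge0// invr_ge0 exprn_ge0// ltW.
- exact: measurable_funS mfx.
apply: filterS u0 => y uy xdy.
have /andP[dN ND] := cube_norm _ _ _ n0 d0 xdy.
have yO : ~ Omega y.
  by move=> Oy; have := eucl_norm_le_diam _ _ _ bO Ox Oy; rewrite leNgt dN.
rewrite lee_fin /f /hquot /= uy// subr0.
by apply: kernel_lower_bound => //; exact: lt_trans dN.
Qed.

End poincare.

(** * Eigenvalues *)

Lemma ge0_integral_comparison d (T : measurableType d) (R : realType)
    (mu : {measure set T -> \bar R}) (D : set T) (a b : T -> R) (p q : R) :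
  measurable D -> 0 <= p -> 0 <= q ->
  measurable_fun D (EFin \o a) -> measurable_fun D (EFin \o b) ->
  (forall x, D x -> 0 <= a x) ->
  (forall x, D x -> p * a x <= b x <= q * a x) ->
  (p%:E * \int[mu]_(x in D) (a x)%:E <= \int[mu]_(x in D) (b x)%:E
    <= q%:E * \int[mu]_(x in D) (a x)%:E)%E.
Proof.
move=> mD p0 q0 ma mb a0 ab; apply/andP; split.
- rewrite -ge0_integralZl//.
  apply: ge0_le_integral => //.
  + by move=> x Dx; rewrite lee_fin mulr_ge0 ?a0.
  + exact: measurable_funeM.
  + by move=> x Dx; rewrite lee_fin; have /andP[] := ab _ Dx.
- rewrite -ge0_integralZl//.
  apply: ge0_le_integral => //.
  + move=> x Dx; rewrite lee_fin; have /andP[+ _] := ab _ Dx.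
    by apply: le_trans; rewrite mulr_ge0 ?a0.
  + exact: measurable_funeM.
  + by move=> x Dx; rewrite lee_fin; have /andP[] := ab _ Dx.
Qed.

(** Turns both integrands of the weak equation tested with u into the form t g(t); at a = 0 both
    sides vanish. *)
Lemma odd_ext_mul (R : realType) (g : R -> R) (a : R) :
  odd_ext g a * a = `|a| * g `|a|.
Proof.
rewrite /odd_ext; have [->|a0] := eqVneq a 0; first by rewrite normr0 !(mulr0, mul0r).
rewrite -mulrA mulrAC -[a * a]expr2 -real_normK ?num_real// expr2 mulfK ?normr_eq0//.
exact: mulrC.
Qed.

Section eigenvalue.
Context {R : realType} {n : nat}.
Variables (s : R) (G g : R -> R) (pm pp : R).
Hypothesis hG : young_function G g.
Hypothesis hpm : 0 < pm.
Hypothesis hp : forall t, 0 < t -> pm <= t * g t / G t /\ t * g t / G t <= pp.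

(** Testing with u gives I = lambda J, where I lies between p^- and p^+ times the energy, and J
    between p^- and p^+ times the modular; the bounds are those of the quotient I/J. *)
Lemma eigenvalue_rayleigh (Omega : set 'rV[R]_n) (u : 'rV[R]_n -> R) (mu lambda : R) :
  open Omega -> 0 < mu -> modular_sphere s G Omega mu u ->
  weak_eigenpair s G g Omega u lambda ->
  ((pm / pp)%:E * (energy s G u / modular G Omega u) <= lambda%:E /\
   lambda%:E <= (pp / pm)%:E * (energy s G u / modular G Omega u))%E.
Proof.
move=> oO mu0 [su umu] /(_ u su); have [[mfu _ Efin] _] := su.
have pp0 : 0 < pp.
  by have [h1 h2] := hp 1 ltr01; exact: lt_le_trans hpm (le_trans h1 h2).
have mO : measurable Omega by exact: open_rV_measurable.
have mG := young_fun_measurable _ _ hG.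
have mg : measurable_fun setT (fun a : R => `|a| * g `|a|).
  by apply: measurable_funM => //; exact: young_density_measurable hG.
have idx (a : R) : pm * G `|a| <= `|a| * g `|a| <= pp * G `|a|.
  by apply: (young_index _ _ hG _ _ hp).
have G0 (a : R) : 0 <= G `|a| by rewrite (young_fun_ge0 _ _ hG).
have w0 (z : 'rV[R]_n * 'rV[R]_n) : 0 <= (eucl_norm (z.1 - z.2) ^+ n)^-1.
  by rewrite invr_ge0 exprn_ge0// eucl_norm_ge0.
under eq_integral do rewrite odd_ext_mul.
under [in RHS]eq_integral do rewrite odd_ext_mul.
set I := (X in X = _); set J := (X in _ = (_ * X)%E) => IJ.
have /andP[I1 I2] : (pm%:E * energy s G u <= I <= pp%:E * energy s G u)%E.
  apply: ge0_integral_comparison => //; rewrite ?ltW//.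
  - exact: (measurable_hquot_div _ _ _ mG mfu).
  - exact: (measurable_hquot_div _ _ _ mg mfu).
  - by move=> z _; rewrite mulr_ge0.
  - move=> z _; have /andP[h1 h2] := idx (hquot s u z.1 z.2).
    by rewrite !mulrA !ler_wpM2r.
have /andP[J1 J2] : (pm%:E * modular G Omega u <= J <= pp%:E * modular G Omega u)%E.
  apply: ge0_integral_comparison => //; rewrite ?ltW//.
  - apply/measurable_EFinP; apply: measurable_funTS; exact: (measurableT_comp mG mfu).
  - apply/measurable_EFinP; apply: measurable_funTS; exact: (measurableT_comp mg mfu).
have E0 : (0 <= energy s G u)%E.
  by apply: integral_ge0 => z _; rewrite lee_fin mulr_ge0.
have : energy s G u \is a fin_num by rewrite ge0_fin_numE.
case: (energy s G u) E0 I1 I2 => // e; rewrite lee_fin => e0 I1 I2 _.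
rewrite umu in J1 J2 *.
(* Both integrals lie between finite bounds, so the equation becomes one between reals. *)
case: I J IJ I1 I2 J1 J2 => [i||] [j||]//; rewrite -?EFinM ?leye_eq ?leeNy_eq//.
move=> [ij]; rewrite !lee_fin => i1 i2 j1 j2.
rewrite inver gt_eqF// -!EFinM !lee_fin.
(* With i >= 0 this gives lambda >= 0, so that the bounds on j may be multiplied by lambda. *)
have j0 : 0 < j by apply: lt_le_trans j1; rewrite mulr_gt0.
have l0 : 0 <= lambda.
  by rewrite -(pmulr_lge0 _ j0) -ij (le_trans _ i1)// mulr_ge0 ?(ltW hpm).
split.
- rewrite mulrA ler_pdivrMr// mulrAC ler_pdivrMr//.
  apply: le_trans i1 _; rewrite ij -mulrA [mu * _]mulrC ler_wpM2l//.
- rewrite mulrA ler_pdivlMr// mulrAC ler_pdivlMr//.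
  apply: le_trans i2; rewrite ij -mulrA [mu * _]mulrC ler_wpM2l//.
Qed.

End eigenvalue.

(** * Uniform constant and comparison of the two infima *)

Theorem corollary5p3 (R : realType) (n : nat) (s pm pp : R)
    (hn : (0 < n)%N) (hs0 : 0 < s) (hs1 : s < 1) (hpm : 1 < pm) :
  exists C : R, 0 < C /\
    forall (Omega : set 'rV[R]_n) (G g : R -> R),
      open Omega -> bounded_set Omega -> Omega !=set0 ->
      young_function G g ->
      (forall t : R, 0 < t -> pm <= t * g t / G t /\ t * g t / G t <= pp) ->
      let d := diam Omega in
      let a1 := alpha1 s G Omega in
      [/\ (0 < a1)%E,
          ((C * Num.min (d `^ (- (s * pm))) (d `^ (- (s * pp))))%:E
             <= (pm / pp)%:E * a1)%E
        & forall (u : R -> 'rV[R]_n -> R) (lambda : R -> R),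
            (forall mu : R, 0 < mu ->
               first_eigenpair s G g Omega mu (u mu) (lambda mu)) ->
            [/\ (0 < lambda1 lambda)%E,
                ((pm / pp)%:E * a1 <= lambda1 lambda)%E
              & (lambda1 lambda <= (pp / pm)%:E * a1)%E]].
Proof.
have pm0 : 0 < pm by exact: lt_trans hpm.
have K0 : 0 < 2 * n%:R :> R by rewrite mulr_gt0 ?ltr0n.
(* The part of the Poincaré constant that remains once the powers of d are split off. *)
pose m : R := Num.min ((2 * n%:R) `^ (- (s * pm))) ((2 * n%:R) `^ (- (s * pp))).
have m0 : 0 < m by rewrite lt_min !powR_gt0.
pose c : R := m * (2 * n%:R) ^- n.
have c0 : 0 < c by rewrite mulr_gt0// invr_gt0 exprn_gt0.
(* If pp < pm no Young function satisfies the growth hypothesis. *)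
have [pp_le|pmpp] := ltP pp pm.
  exists 1; split => // Omega G g _ _ _ _ /(_ 1 ltr01)[h1 h2].
  by have := le_trans h1 h2; rewrite leNgt pp_le.
have pp0 : 0 < pp := lt_le_trans pm0 pmpp.
exists (pm / pp * c); split; first by rewrite mulr_gt0// divr_gt0.
move=> Omega G g oO bO O0 hG hp d a1.
have d0 : 0 < d by exact: diam_gt0.
set md := Num.min (d `^ _) _.
have md0 : 0 < md by rewrite lt_min !powR_gt0.
have cmd0 : (0 < (c * md)%:E)%E by rewrite lte_fin mulr_gt0.
(* The Poincaré inequality bounds every Rayleigh quotient below, uniformly in mu and u. *)
have ca : ((c * md)%:E <= a1)%E.
  apply: le_ereal_inf_tmp => _ [mu /= mu0 <-]; apply: le_ereal_inf_tmp => _ [u [su umu] <-].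
  have := orlicz_poincare _ _ _ hG _ _ hs0 pm0 hp Omega u hn oO bO O0 su.
  rewrite umu inver gt_eqF// lee_pdivlMr//.
  apply: le_trans; rewrite -!EFinM lee_fin ler_wpM2r ?(ltW mu0)//.
  rewrite /c mulrAC ler_wpM2r ?invr_ge0 ?exprn_ge0 ?(ltW K0)//.
  (* The minimum of the products dominates the product of the minima. *)
  rewrite !(powRM _ (ltW K0) (ltW d0)) le_min.
  by apply/andP; split; apply: ler_pM; rewrite ?(ltW m0) ?(ltW md0) /m /md ?ge_min ?lexx ?orbT.
have a10 : (0 < a1)%E by exact: lt_le_trans ca.
have ratio0 : 0 < pm / pp by rewrite divr_gt0.
split => //.
  by rewrite -mulrA EFinM lee_wpmul2l ?lee_fin ?(ltW ratio0).
move=> u lambda hu.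
have bound mu : 0 < mu -> ((pm / pp)%:E * alpha1_at s G Omega mu <= (lambda mu)%:E /\
    (lambda mu)%:E <= (pp / pm)%:E * alpha1_at s G Omega mu)%E.
  move=> mu0; have [su _ <- wu] := hu mu mu0.
  exact: (eigenvalue_rayleigh _ _ _ _ _ hG pm0 hp _ _ _ _ oO mu0 su wu).
have a1l : ((pm / pp)%:E * a1 <= lambda1 lambda)%E.
  apply: le_ereal_inf_tmp => _ [mu /= mu0 <-]; have [h _] := bound mu mu0.
  apply: le_trans h; rewrite lee_wpmul2l ?lee_fin ?(ltW ratio0)//.
  by apply: ereal_inf_lbound; exists mu.
split => //.
  by apply: lt_le_trans a1l; rewrite mule_gt0.
(* Moving the factor to the left lets the bound be checked at each mu in the infimum defining
   [a1]. *)
rewrite -(invf_div pm pp) lee_pdivlMl//.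
apply: le_ereal_inf_tmp => _ [mu /= mu0 <-]; have [_ h] := bound mu mu0.
rewrite -lee_pdivlMl// invf_div; apply: le_trans h.
by apply: ereal_inf_lbound; exists mu.
Qed.
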